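(* Let $A$ be a cyclic (gapped filtered) $A_\infty$-algebra. Then $m^+$ gives rise to a well-defined function on $C_\bullet(A,A)/\mathrm{Im}(d^{Hoch})$; that is, $m^+\circ d^{Hoch}=0$ on $C_\bullet(A,A)$. In particular $m^+$ defines a function on the Hochschild homology of $A$ and on the Chevalley–Eilenberg homology of the underlying $L_\infty$-algebra $\widetilde A$, $$m^+:H_\bullet(A,A)\to\Lambda_{0,nov},\qquad m^+:H^{CE}_\bullet(\widetilde A,\widetilde A)\to\Lambda_{0,nov}.$$
   Context: **Novikov ring.** Let $\boldsymbol{k}$ be a field of characteristic $0$. $\Lambda_{0,nov}$ is the ring of formal sums $\sum_{i\ge0}a_iT^{\lambda_i}e^{q_i}$ with $a_i\in\boldsymbol{k}$, $\lambda_i\in\mathbb{R}_{\ge0}$, $q_i\in\mathbb{Z}$, $\lim\lambda_i=\infty$; $T,e$ are formal parameters of degrees $0$ and $2$. **Filtered $A_\infty$-algebra.** $G\subset\mathbb{R}_{\ge0}\times2\mathbb{Z}$ is a monoid whose projection to $\mathbb{R}_{\ge0}$ is discrete, with $G\cap(\{0\}\times2\mathbb{Z})=\{(0,0)\}$ and $G\cap(\{\lambda\}\times2\mathbb{Z})$ finite for all $\lambda$. $A=\overline A\otimes_{\boldsymbol{k}}\Lambda_{0,nov}$ with $\overline A$ a finite-dimensional graded $\boldsymbol{k}$-vector space; $|x|'=|x|-1$ is the shifted degree (degree in $A[1]$). For $k\ge0$ and $\beta=(\lambda(\beta),\mu(\beta))\in G$ there are maps $m_{k,\beta}:\overline A[1]^{\otimes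 k}\to\overline A[1]$ with $m_{0,(0,0)}=0$, and $m_k=\sum_{\beta\in G}T^{\lambda(\beta)}e^{\mu(\beta)/2}m_{k,\beta}$ is of degree $1$. Set $$\widehat m_k(x_1\otimes\cdots\otimes x_n)=\sum_{i=1}^{n-k+1}(-1)^{|x_1|'+\cdots+|x_{i-1}|'}x_1\otimes\cdots\otimes m_k(x_i,\dots,x_{i+k-1})\otimes\cdots\otimes x_n$$ for $k\le n$, and $0$ for $k>n$, and $\widehat d=\sum_{k\ge0}\widehat m_k$. The $A_\infty$-equations are $\widehat d\circ\widehat d=0$. **Cyclicity.** $A$ is cyclic if there is a non-degenerate bilinear map $\langle\,,\rangle:\overline A[1]\otimes\overline A[1]\to\boldsymbol{k}$, extended linearly to $A$, graded skew-symmetric ($\langle a,b\rangle=-(-1)^{|a|'|b|'}\langle b,a\rangle$), such that for all $k\ge0$, $\beta\in G$, $$\langle m_{k,\beta}(x_1,\dots,x_k),x_{k+1}\rangle=(-1)^K\langle m_{k,\beta}(x_2,\dots,x_{k+1}),x_1\rangle,\quad K=|x_1|'(|x_2|'+\cdots+|x_{k+1}|').$$ **The function $m^+$.** For $k\ge1$, $m^+(x_1\otimes\cdots\otimes x_k)=m_k^+(x_1,\dots,x_k)=\langle m_{k-1}(x_1,\dots,x_{k-1}),x_k\rangle$, extended linearly (and continuously for the energy filtration). **Hochschild complex.** $C_\bullet(A,A)$ is the completion, with respect to the energy filtration, of $\bigoplus_{k\ge0}A[1]\otimes A[1]^{\otimes k}$; the first (module) factor is underlined. The differential is $$d^{Hoch}(\underline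 v\otimes x_1\otimes\cdots\otimes x_k)=\sum_{i\ge1,\ 0\le j\le k+1-i}(-1)^{\epsilon_1}\underline v\otimes\cdots\otimes x_{i-1}\otimes m_j(x_i,\dots,x_{i+j-1})\otimes\cdots\otimes x_k$$ $$+\sum_{0\le i,j\le k,\ i+j\le k}(-1)^{\epsilon_2}\underline{m_{i+j+1}(x_{k-i+1},\dots,x_k,v,x_1,\dots,x_j)}\otimes x_{j+1}\otimes\cdots\otimes x_{k-i},$$ $\epsilon_1=|v|'+|x_1|'+\cdots+|x_{i-1}|'$, $\epsilon_2=\big(\sum_{s=1}^i|x_{k-i+s}|'\big)\big(|v|'+\sum_{t=1}^j|x_t|'\big)$. $H_\bullet(A,A)$ is its homology. On chains, $m^+(\underline{x_0}\otimes x_1\otimes\cdots\otimes x_k)=m^+_{k+1}(x_0,\dots,x_k)$. **Chevalley–Eilenberg complex.** $\widetilde A$ is the $L_\infty$-algebra obtained from $A$ by graded symmetrization of the $m_k$. Write $[x_1,\dots,x_k]=\sum_{\tau\in S_k}(-1)^{\epsilon(\tau,\vec x)}x_{\tau(1)}\otimes\cdots\otimes x_{\tau(k)}$, with $(-1)^{\epsilon(\tau,\vec x)}$ the Koszul sign in the shifted degrees. The Chevalley–Eilenberg chains (with coefficients in $\widetilde A$) are the elements of $C_\bullet(A,A)$ generated by the $\underline{x_0}\otimes[x_1,\dots,x_k]$, with differential $d^{CE}(\underline{x_0}\otimes[x_1,\dots,x_k])=d^{Hoch}(\underline{x_0}\otimes[x_1,\dots,x_k])$; $H^{CE}_\bullet(\widetilde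 A,\widetilde A)$ is the homology and $m^+$ is restricted from $C_\bullet(A,A)$.
   Formalization: The sign ε_2 in d^Hoch is corrected: the second factor is |v|' plus the sum of |x_t|' over t=1..k-i (not t=1..j), the full Koszul sign; with the printed sign m^+∘d^Hoch is not 0, e.g. on 1⊗1⊗θ⊗1 for H^*(S^1). *)

(* Defs.v *)
From HB Require Import structures.
From mathcomp Require Import all_boot all_order all_algebra perm.
From mathcomp Require Import generic_quotient ring_quotient sesquilinear.
From mathcomp Require Import all_classical reals.

Set Implicit Arguments.
Unset Strict Implicit.
Unset Printing Implicit Defensive.

Import Order.TTheory GRing.Theory Num.Theory.

Local Open Scope classical_set_scope.
Local Open Scope ring_scope.

(* [nov R K X] is the completed free Lambda_{0,nov}-module on the set X, i.e.
   the formal sums  sum_i a_i T^{l_i} e^{q_i} x_i  with a_i in K, l_i >= 0,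
   q_i in Z, x_i in X and lim l_i = +oo: [f (l, q, x)] is the coefficient of
   T^l e^q x, and only finitely many coefficients of energy l <= E are nonzero.
   Lambda_{0,nov} itself is the case where X is a point.  If V is a K-vector
   space with basis X, then [nov R K X] is the completion of V (x)_K Lambda for
   the energy filtration; when X is finite this is V (x)_K Lambda. *)
Section Nov.
Context (R : realType) (K : fieldType) (X : choiceType).

Definition nov_pred : {pred R * int * X -> K} := fun f => `[<
  (forall p, p.1.1 < 0 -> f p = 0) /\
  (forall E : R, finite_set [set p | p.1.1 <= E /\ f p != 0]) >].

Lemma nov_predP f : reflect ((forall p, p.1.1 < 0 -> f p = 0) /\
  (forall E : R, finite_set [set p | p.1.1 <= E /\ f p != 0])) (f \in nov_pred).
Proof. exact: asboolP. Qed.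

Lemma nov_pred_zmod_closed : zmod_closed nov_pred.
Proof.
split=> [|f g /nov_predP[f0 fE] /nov_predP[g0 gE]]; apply/nov_predP.
  by split=> // E; apply: (sub_finite_set _ (finite_set0 _)) => p /= [_]; rewrite eqxx.
split=> [p p0|E]; first by rewrite -[LHS]/(f p - g p) f0 // g0 // subrr.
apply: (@sub_finite_set _ _ ([set p | p.1.1 <= E /\ f p != 0] `|`
  [set p | p.1.1 <= E /\ g p != 0])); last by rewrite finite_setU.
move=> p /= [pE fgp]; have [fp|fp] := eqVneq (f p) 0; last by left.
right; split=> //; apply: contra_neq fgp => gp.
by rewrite -[LHS]/(f p - g p) fp gp subrr.
Qed.

HB.instance Definition _ :=
  GRing.isZmodClosed.Build (R * int * X -> K) nov_pred nov_pred_zmod_closed.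

Record nov := Nov { nov_fun :> R * int * X -> K; _ : nov_fun \in nov_pred }.

HB.instance Definition _ := [isSub for nov_fun].
HB.instance Definition _ := [Choice of nov by <:].
HB.instance Definition _ := [SubChoice_isSubZmodule of nov by <:].

Definition nsupp (f : nov) (E : R) := [set p | p.1.1 <= E /\ f p != 0].

Lemma nov_lt0 (f : nov) p : p.1.1 < 0 -> f p = 0.
Proof. by case: f => f /= /nov_predP[f0 _]; apply: f0. Qed.

Lemma nov_fin (f : nov) E : finite_set (nsupp f E).
Proof. by case: f => f fP; have /nov_predP[_] := fP; apply. Qed.

Lemma novP (f g : nov) : (forall p, f p = g p) -> f = g.
Proof. by move=> fg; apply: val_inj; apply/funext. Qed.

Lemma nov0E p : nov_fun 0 p = 0. Proof. by []. Qed.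
Lemma novDE (f g : nov) p : nov_fun (f + g) p = f p + g p. Proof. by []. Qed.
Lemma novBE (f g : nov) p : nov_fun (f - g) p = f p - g p. Proof. by []. Qed.

(* c T^0 e^0 x *)
Definition mono_fun (c : K) (x : X) : R * int * X -> K :=
  fun p => if p == (0, 0, x) then c else 0.

Lemma mono_subproof c x : mono_fun c x \in nov_pred.
Proof.
apply/nov_predP; split=> [p p0|E].
  rewrite /mono_fun; case: eqP => // pE.
  by move: p0; rewrite pE /= ltxx.
apply: (@sub_finite_set _ _ [set (0, 0, x)]) => // p /= [_].
by rewrite /mono_fun; case: (p =P _) => // _; rewrite eqxx.
Qed.

Definition mono c x : nov := Nov (mono_subproof c x).

End Nov.

(* The continuous Lambda-linear extension to [nov R K X] of a map defined on
   the basis X. *)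
Section Bind.
Context (R : realType) (K : fieldType) (X Y : choiceType).
Implicit Types (f : nov R K X) (g : X -> nov R K Y).

(* All terms with s.1.1 > p.1.1 vanish, so that the sum is finite. *)
Definition bind_fun f g : R * int * Y -> K := fun p =>
  \sum_(s \in [set: R * int * X])
     f s * g s.2 (p.1.1 - s.1.1, p.1.2 - s.1.2, p.2).

Lemma bind_funE (D : set (R * int * X)) f g p :
  nsupp f p.1.1 `<=` D ->
  bind_fun f g p =
  \sum_(s \in D) f s * g s.2 (p.1.1 - s.1.1, p.1.2 - s.1.2, p.2).
Proof.
move=> fD; apply/esym/fsbig_widen => // s /= [_ Ds].
have [sp|ps] := leP s.1.1 p.1.1; last first.
  by rewrite (nov_lt0 (g s.2)) ?mulr0 // subr_lt0.
have [->|fs] := eqVneq (f s) 0; first by rewrite mul0r.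
by case: Ds; apply: fD.
Qed.

Definition bsupp f g (E : R) := \bigcup_(r in nsupp f E)
  [set s : R * int * Y | s.1.1 <= E /\
     g r.2 (s.1.1 - r.1.1, s.1.2 - r.1.2, s.2) != 0].

Lemma bsupp_fin f g E : finite_set (bsupp f g E).
Proof.
apply: bigcup_finite => [|r _]; first exact: nov_fin.
apply: (@sub_finite_set _ _ ((fun s : R * int * Y =>
    (s.1.1 + r.1.1, s.1.2 + r.1.2, s.2)) @` nsupp (g r.2) (E - r.1.1))).
  move=> [[l q] y] /= [lE gN0]; exists (l - r.1.1, q - r.1.2, y).
    by split=> //=; rewrite lerD2r.
  by rewrite /= !subrK.
exact/finite_image/nov_fin.
Qed.

Lemma bind_nsupp f g E :
  [set p | p.1.1 <= E /\ bind_fun f g p != 0] `<=` bsupp f g E.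
Proof.
move=> p /= [pE]; apply: contra_neqP => pB.
rewrite (@bind_funE (nsupp f E)); last first.
  by move=> s [/= sp fs]; split=> //; apply: le_trans sp pE.
apply: fsbig1 => s fs; apply/eqP; rewrite mulf_eq0; apply/orP; right.
by apply: contrapT => /negP gs; apply: pB; exists s.
Qed.

Lemma bind_subproof f g : bind_fun f g \in @nov_pred R K Y.
Proof.
apply/nov_predP; split=> [p p0|E]; last exact: sub_finite_set (@bind_nsupp f g E) (bsupp_fin f g E).
rewrite (@bind_funE set0) ?fsbig_set0 // => s /= [sp].
by rewrite nov_lt0 ?eqxx //; apply: le_lt_trans p0.
Qed.

Definition bind f g : nov R K Y := Nov (bind_subproof f g).

Lemma bindE (D : set (R * int * X)) f g p : nsupp f p.1.1 `<=` D ->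
  bind f g p =
  \sum_(s \in D) f s * g s.2 (p.1.1 - s.1.1, p.1.2 - s.1.2, p.2).
Proof. exact: bind_funE. Qed.

Lemma bindDl f f' g : bind (f + f') g = bind f g + bind f' g.
Proof.
apply: novP => p; rewrite novDE.
pose D := nsupp f p.1.1 `|` nsupp f' p.1.1.
have Dfin : finite_set D by rewrite finite_setU; split; apply: nov_fin.
rewrite (@bindE D f) ?(@bindE D f') ?(@bindE D (f + f')); first 1 last.
- move=> s [sp ff's]; have {}ff's : f s + f' s != 0 := ff's.
  have [fs|fs] := eqVneq (f s) 0; last by left.
  by right; split=> //; rewrite fs add0r in ff's.
- by move=> s; right.
- by move=> s; left.
by rewrite -fsbig_split //; apply: eq_fsbigr => s _; rewrite novDE mulrDl.
Qed.

Lemma bindBl f f' g : bind (f - f') g = bind f g - bind f' g.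
Proof. by apply/eqP; rewrite eq_sym subr_eq -bindDl subrK. Qed.

Lemma bindDr f g g' : bind f (fun x => g x + g' x) = bind f g + bind f g'.
Proof.
apply: novP => p; rewrite novDE !(@bindE (nsupp f p.1.1)) //.
rewrite -fsbig_split //; last exact: nov_fin.
by apply: eq_fsbigr => s _; rewrite novDE mulrDr.
Qed.

Lemma bind_monol c x g p : bind (mono R c x) g p = c * g x p.
Proof.
rewrite (@bindE [set (0, 0, x)]) ?fsbig_set1 /=; last first.
  by move=> s [_]; rewrite /= /mono_fun; case: (s =P _) => // _; rewrite eqxx.
by rewrite /mono_fun eqxx !subr0; case: p => [[? ?] ?].
Qed.

End Bind.

Lemma bindA (R : realType) (K : fieldType) (X Y Z : choiceType)
    (f : nov R K X) (g : X -> nov R K Y) (h : Y -> nov R K Z) :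
  bind (bind f g) h = bind f (fun x => bind (g x) h).
Proof.
apply: novP => p; set E := p.1.1.
rewrite (@bindE _ _ _ _ (bsupp f g E)); last exact: bind_nsupp.
rewrite (@bindE _ _ _ _ (nsupp f E)) //.
transitivity (\sum_(s \in bsupp f g E) \sum_(r \in nsupp f E)
    f r * g r.2 (s.1.1 - r.1.1, s.1.2 - r.1.2, s.2) *
      h s.2 (p.1.1 - s.1.1, p.1.2 - s.1.2, p.2)).
  apply: eq_fsbigr => s; rewrite inE => -[r _ [sE _]].
  rewrite (@bindE _ _ _ _ (nsupp f E)) ?mulr_fsuml //.
  by move=> t [/= ts ft]; split=> //; apply: le_trans ts sE.
rewrite exchange_fsbig; [|exact: bsupp_fin|exact: nov_fin].
apply: eq_fsbigr => r; rewrite inE => rf.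
under eq_fsbigr do rewrite -mulrA.
rewrite -mulr_fsumr; congr (_ * _); rewrite [RHS]/=/bind_fun.
pose sh (s : R * int * Y) := (s.1.1 - r.1.1, s.1.2 - r.1.2, s.2).
rewrite (reindex_fsbigT sh); last first.
  exists (fun s => (s.1.1 + r.1.1, s.1.2 + r.1.2, s.2)) => -[[l q] y];
  by rewrite /sh /= ?subrK ?addrK.
rewrite [LHS](fsbig_widen _ setT) //.
  apply: eq_fsbigr => s _; rewrite /sh /=; congr (_ * h _ (_, _, _)).
    by rewrite opprB addrA subrK.
  by rewrite opprB addrA subrK.
move=> s /= [_ sB].
have [sp|ps] := leP s.1.1 E; last first.
  by rewrite (nov_lt0 (h s.2)) ?mulr0 // subr_lt0.
suff -> : g r.2 (s.1.1 - r.1.1, s.1.2 - r.1.2, s.2) = 0 by rewrite mul0r.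
by apply/eqP; apply: contrapT => /negP gs; apply: sB; exists r.
Qed.

Section Novikov.
Context (R : realType) (K : fieldType).

Definition novikov := nov R K unit.

HB.instance Definition _ := GRing.Zmodule.on novikov.

Definition nov_mul (a b : novikov) : novikov := bind a (fun=> b).
Definition nov_one : novikov := mono R 1 tt.

Lemma nov_mulA : associative nov_mul.
Proof. by move=> a b c; rewrite /nov_mul bindA. Qed.

Lemma nov_mulC : commutative nov_mul.
Proof.
move=> a b; apply: novP => -[[l q] []]; rewrite [LHS]/=/bind_fun.
pose op (s : R * int * unit) := (l - s.1.1, q - s.1.2, tt).
rewrite (reindex_fsbigT op); last first.
  by exists op => -[[l' q'] []]; rewrite /op /= !subKr.
apply: eq_fsbigr => -[[l' q'] []] _; rewrite /op /= mulrC.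
by rewrite !subKr.
Qed.

Lemma nov_mul1 : left_id nov_one nov_mul.
Proof. by move=> a; apply: novP => p; rewrite bind_monol mul1r. Qed.

Lemma nov_mulDl : left_distributive nov_mul +%R.
Proof. by move=> a b c; apply: bindDl. Qed.

Lemma nov_one_neq0 : nov_one != 0.
Proof.
apply/eqP => /(congr1 (fun f : nov R K unit => f (0, 0, tt))) /eqP.
by rewrite /= /mono_fun eqxx oner_eq0.
Qed.

HB.instance Definition _ := GRing.Zmodule_isComNzRing.Build novikov
  nov_mulA nov_mulC nov_mul1 nov_mulDl nov_one_neq0.

Section Module.
Context (X : choiceType).

Definition nov_scale (a : novikov) (f : nov R K X) : nov R K X := bind a (fun=> f).

Lemma nov_scaleA a b f : nov_scale a (nov_scale b f) = nov_scale (a * b) f.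
Proof. by rewrite /nov_scale bindA. Qed.

Lemma nov_scale1 : left_id 1 nov_scale.
Proof. by move=> f; apply: novP => p; rewrite bind_monol mul1r. Qed.

Lemma nov_scaleDr : right_distributive nov_scale +%R.
Proof. by move=> a f g; apply: bindDr. Qed.

Lemma nov_scaleDl f : {morph nov_scale^~ f : a b / a + b}.
Proof. by move=> a b; apply: bindDl. Qed.

HB.instance Definition _ := GRing.Zmodule_isLmodule.Build novikov (nov R K X)
  nov_scaleA nov_scale1 nov_scaleDr nov_scaleDl.

End Module.

Section Extension.
Context (X Y : choiceType) (g : X -> nov R K Y).

Definition lext (f : nov R K X) : nov R K Y := bind f g.

Lemma lext_is_linear : linear lext.
Proof. by move=> a f f'; rewrite /lext bindDl; congr (_ + _); apply: bindA. Qed.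

HB.instance Definition _ := GRing.isLinear.Build novikov
  (nov R K X) (nov R K Y) *:%R lext lext_is_linear.

End Extension.

End Novikov.

(* [homology d S] is the homology of the subcomplex S of (C, d).  It is formed
   as the cycles in S modulo those cycles which are boundaries of elements of
   S, and is thus Ker d / Im d as soon as d preserves S and d \o d = 0 on S. *)
Section Homology.
Context (C : zmodType) (d : {additive C -> C}) (S : zmodClosed C).

Definition cycle_pred : {pred C} := fun x => (x \in S) && (d x == 0).

Lemma cycle_predE x : (x \in cycle_pred) = (x \in S) && (d x == 0).
Proof. by []. Qed.

Lemma cycle_zmod_closed : zmod_closed cycle_pred.
Proof.
split=> [|x y]; rewrite !cycle_predE; first by rewrite rpred0 raddf0 eqxx.
move=> /andP[xS /eqP dx] /andP[yS /eqP dy].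
by rewrite rpredB //= raddfB dx dy subrr.
Qed.

HB.instance Definition _ := GRing.isZmodClosed.Build C cycle_pred cycle_zmod_closed.

Record cycles := Cycle { cycle_val :> C; _ : cycle_val \in cycle_pred }.

HB.instance Definition _ := [isSub for cycle_val].
HB.instance Definition _ := [Choice of cycles by <:].
HB.instance Definition _ := [SubChoice_isSubZmodule of cycles by <:].

Definition boundary : {pred cycles} :=
  fun z => `[< exists2 y, y \in S & d y = cycle_val z >].

Lemma boundary_zmod_closed : zmod_closed boundary.
Proof.
split=> [|z1 z2 /asboolP[y1 y1S y1E] /asboolP[y2 y2S y2E]]; apply/asboolP.
  by exists 0; rewrite ?rpred0 ?raddf0.
by exists (y1 - y2); rewrite ?rpredB // raddfB y1E y2E.
Qed.

HB.instance Definition _ :=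
  GRing.isZmodClosed.Build cycles boundary boundary_zmod_closed.

Definition homology := {ideal_quot boundary}.

Definition im_pred : {pred C} := fun x => `[< exists y, d y = x >].

Lemma im_zmod_closed : zmod_closed im_pred.
Proof.
split=> [|x1 x2 /asboolP[y1 <-] /asboolP[y2 <-]]; apply/asboolP.
  by exists 0; rewrite raddf0.
by exists (y1 - y2); rewrite raddfB.
Qed.

HB.instance Definition _ := GRing.isZmodClosed.Build C im_pred im_zmod_closed.

Definition coker := {ideal_quot im_pred}.

End Homology.

(* The whole of C, as an additively closed predicate. *)
Section Full.
Context (C : zmodType).

Definition full : {pred C} := fun=> true.

Lemma full_zmod_closed : zmod_closed full. Proof. by []. Qed.

HB.instance Definition _ := GRing.isZmodClosed.Build C full full_zmod_closed.

End Full.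

(* beta = (lambda(beta), mu(beta)). *)
Record gapping (R : realType) := Gapping {
  gap : set (R * int);
  gap_ge0 : forall b, gap b -> 0 <= b.1;
  gap_even : forall b, gap b -> (2 %| b.2)%Z;
  gap_0 : gap (0, 0);
  gap_D : forall b c, gap b -> gap c -> gap (b.1 + c.1, b.2 + c.2);
  (* the projection to R is a closed discrete subset of [0, +oo[ *)
  gap_discrete : forall E : R, finite_set [set l | l <= E /\ exists mu, gap (l, mu)];
  gap_energy0 : forall mu, gap (0, mu) -> mu = 0;
  gap_fiber : forall l : R, finite_set [set mu | gap (l, mu)]
}.

Lemma gap_finite (R : realType) (G : gapping R) (E : R) :
  finite_set [set b | gap G b /\ b.1 <= E].
Proof.
apply: (@sub_finite_set _ _ (\bigcup_(l in [set l | l <= E /\ exists mu, gap G (l, mu)])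
    ((fun mu => (l, mu)) @` [set mu | gap G (l, mu)]))); last first.
  apply: bigcup_finite => [|l _]; first exact: gap_discrete.
  exact/finite_image/gap_fiber.
by move=> [l mu] /= [Gb lE]; exists l => /=; [split=> //; exists mu|exists mu].
Qed.

(* A finite-dimensional graded K-vector space \bar A is given by a homogeneous
   basis I, together with the degrees of its elements: \bar A is the space of
   functions on I, and its n-th tensor power that of functions on I^n.  All
   signs involve the degrees |x|' = |x| - 1 of \bar A[1], and [shomog n] is
   homogeneity of degree n in \bar A[1]. *)
Section GradedSpace.
Context (K : fieldType) (I : finType) (deg : I -> int).

Definition vec := {ffun I -> K^o}.
Definition tens n := {ffun n.-tuple I -> K^o}.

HB.instance Definition _ := GRing.Lmodule.on vec.
HB.instance Definition _ n := GRing.Lmodule.on (tens n).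

Definition evec (i : I) : vec := [ffun j => (i == j)%:R].

Definition tpure n (x : 'I_n -> vec) : tens n :=
  [ffun t : n.-tuple I => \prod_(i < n) x i (tnth t i)].

Definition sdeg (i : I) : int := deg i - 1.

Definition shomog (n : int) (v : vec) := forall i, v i != 0 -> sdeg i = n.

Definition wdeg (w : seq I) : int := \sum_(i <- w) sdeg i.

End GradedSpace.

(* [op k b] is m_{k, b}; its values for b outside of the gapping monoid are
   irrelevant. *)
Record ainf_ops (R : realType) (K : fieldType) := AinfOps {
  idx : finType;
  deg : idx -> int;
  mon : gapping R;
  op : forall k, R * int -> {linear tens K idx k -> vec K idx}
}.

Section Operations.
Context (R : realType) (K : fieldType) (A : ainf_ops R K).
Local Notation I := (idx A).
Local Notation sdeg := (sdeg (@deg _ _ A)).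
Local Notation wdeg := (wdeg (@deg _ _ A)).
Local Notation shomog := (shomog (@deg _ _ A)).

Definition mcoef (b : R * int) (w : seq I) : vec K I :=
  op A (size w) b (tpure (fun i => evec K (tnth (in_tuple w) i))).

(* m_k(w) = sum_{b in G} T^{lambda(b)} e^{mu(b)/2} m_{k,b}(w), for k = size w *)
Definition m_fun (w : seq I) : R * int * I -> K := fun p =>
  if `[< gap (mon A) (p.1.1, 2 * p.1.2) >] then mcoef (p.1.1, 2 * p.1.2) w p.2 else 0.

Lemma m_subproof w : m_fun w \in @nov_pred R K I.
Proof.
apply/nov_predP; split=> [p p0|E].
  rewrite /m_fun; case: asboolP => // /gap_ge0 /=.
  by rewrite leNgt p0.
apply: (@sub_finite_set _ _ ((fun x : (R * int) * I => (x.1.1, (x.1.2 %/ 2)%Z, x.2)) @`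
    ([set b | gap (mon A) b /\ b.1 <= E] `*` setT))); last first.
  by apply/finite_image/finite_setX => //; apply: gap_finite.
move=> [[l q] y] /= [lE]; rewrite /m_fun /=; case: asboolP => [Gb _|]; last by rewrite eqxx.
by exists (l, 2 * q, y) => //=; rewrite mulKz.
Qed.

Definition m (w : seq I) : nov R K I := Nov (m_subproof w).

(* \hat m_k and \hat d, on the completed tensor coalgebra of A[1] *)
Definition mhat_gen k (w : seq I) : nov R K (seq I) :=
  if (k <= size w)%N then
    \sum_(i < (size w - k).+1)
      lext (fun y => mono R ((-1) ^ wdeg (take i w)) (take i w ++ y :: drop (i + k) w))
        (m (take k (drop i w)))
  else 0.

(* The sum over all k >= 0: \hat m_k vanishes on words of length < k. *)
Definition dhat_gen (w : seq I) : nov R K (seq I) :=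
  \sum_(k < (size w).+1) mhat_gen k w.

Definition dhat : nov R K (seq I) -> nov R K (seq I) := lext dhat_gen.

(* [(v, x)] stands for the chain \underline{v} (x) x_1 (x) ... (x) x_k. *)
Definition hoch := nov R K (I * seq I)%type.

(* In the first sum i counts the letters of x to the left of the inserted
   operation.  In the second one, i letters are taken from the end of x; the
   sign is the Koszul sign for moving them in front of v and of all of
   x_1, ..., x_(k-i), which is what makes dhoch a differential.  The sign that
   only involves v and x_1, ..., x_j gives dhoch \o dhoch != 0. *)
Definition dhoch_gen (c : I * seq I) : hoch :=
  let v := c.1 in let x := c.2 in let k := size x in
  \sum_(i < k.+1) \sum_(j < k.+1 | (i + j <= k)%N)
    lext (fun y => mono R ((-1) ^ (sdeg v + wdeg (take i x)))
                     (v, take i x ++ y :: drop (i + j) x))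
      (m (take j (drop i x)))
  + \sum_(i < k.+1) \sum_(j < k.+1 | (i + j <= k)%N)
    lext (fun y => mono R ((-1) ^ (wdeg (drop (k - i) x) *
                                   (sdeg v + wdeg (take (k - i) x))))
                     (y, drop j (take (k - i) x)))
      (m (drop (k - i) x ++ v :: take j x)).

Definition dhoch : hoch -> hoch := lext dhoch_gen.

HB.instance Definition _ := GRing.Zmodule.on hoch.
HB.instance Definition _ := GRing.Linear.on dhoch.

Definition koszul (x : seq I) (s : 'S_(size x)) : int :=
  let d i := sdeg (tnth (in_tuple x) (s i)) in
  \sum_(i < size x) \sum_(j < size x | (i < j)%N && (s j < s i)%N) d i * d j.

(* \underline{v} (x) [x_1, ..., x_k]; the image of its Lambda-linear extension
   is the completed Lambda-span of these chains, for arbitrary x_i. *)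
Definition ce_gen (c : I * seq I) : hoch :=
  \sum_(s : 'S_(size c.2))
    mono R ((-1) ^ koszul s)
      (c.1, [seq tnth (in_tuple c.2) (s i) | i <- enum 'I_(size c.2)]).

Definition ce_chain : {pred hoch} := fun c => `[< exists f, lext ce_gen f = c >].

Lemma ce_zmod_closed : zmod_closed ce_chain.
Proof.
split=> [|x1 x2 /asboolP[y1 <-] /asboolP[y2 <-]]; apply/asboolP.
  by exists 0; rewrite raddf0.
by exists (y1 - y2); rewrite raddfB.
Qed.

HB.instance Definition _ := GRing.isZmodClosed.Build hoch ce_chain ce_zmod_closed.

Definition hoch_coker := coker dhoch.

Definition hoch_cycles := cycles dhoch (@full hoch).
Definition hoch_homology := homology dhoch (@full hoch).
Definition ce_cycles := cycles dhoch ce_chain.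
Definition ce_homology := homology dhoch ce_chain.

End Operations.

Arguments dhoch {R K} A _.
Arguments ce_chain {R K} A _.

(* Gapped filtered A_infinity-algebras; [op k b] has degree 1 - mu(b) since
   e has degree 2. *)
Record ainf (R : realType) (K : fieldType) := Ainf {
  ops :> ainf_ops R K;
  op00 : forall x, op ops 0 (0, 0) x = 0;
  op_deg : forall k b (x : 'I_k -> vec K (idx ops)) (d : 'I_k -> int),
    gap (mon ops) b -> (forall i, shomog (@deg _ _ ops) (d i) (x i)) ->
    shomog (@deg _ _ ops) (\sum_i d i + 1 - b.2) (op ops k b (tpure x));
  dhat_sq : forall c, dhat (dhat c : nov R K (seq (idx ops))) = 0
}.

(* By skew-symmetry, [pair_nondeg] also holds on the other side. *)
Record cyclic_ainf (R : realType) (K : fieldType) := CyclicAinf {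
  alg :> ainf R K;
  pairing : {biscalar (vec K (idx alg))};
  pair_nondeg : forall x, (forall y, pairing x y = 0) -> x = 0;
  pair_skew : forall p q x y,
    shomog (@deg _ _ alg) p x -> shomog (@deg _ _ alg) q y ->
    pairing x y = - (-1) ^ (p * q) * pairing y x;
  pair_cyclic : forall k b (x : 'I_k.+1 -> vec K (idx alg)) (d : 'I_k.+1 -> int),
    gap (mon alg) b -> (forall i, shomog (@deg _ _ alg) (d i) (x i)) ->
    pairing (op alg k b (tpure (fun i => x (lift ord_max i)))) (x ord_max) =
    (-1) ^ (d ord0 * \sum_(i < k) d (lift ord0 i)) *
    pairing (op alg k b (tpure (fun i => x (lift ord0 i)))) (x ord0)
}.

Section MPlus.
Context (R : realType) (K : fieldType) (A : cyclic_ainf R K).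
Local Notation I := (idx A).

(* The Lambda-bilinear extension of the pairing *)
Definition lpair (a b : nov R K I) : novikov R K :=
  lext (fun i => lext (fun j => mono R (pairing A (evec K i) (evec K j)) tt) b) a.

Definition mplus_gen (c : I * seq I) : novikov R K :=
  lpair (m (belast c.1 c.2)) (mono R 1 (last c.1 c.2)).

Definition mplus : hoch A -> novikov R K := lext mplus_gen.

End MPlus.

Arguments mplus {R K} A _.

(* Main.v *)
(* By cyclicity of the pairing, m^+ is invariant under cyclic rotation of words,
   up to the Koszul sign.  Hence a term of m^+ (d^Hoch (v (x) x)) only depends,
   up to sign, on an arc B of the cyclic word v x: rotating the inserted letter
   m(B) to the end gives <m(B'), m(B)> with B' the complementary arc.  Since m is
   odd and the pairing is skew-symmetric, the terms of B and B' are equal, sign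
   included; so the arcs containing v contribute as much as those avoiding v.
   Rotating v to the end instead, the latter sum up to the pairing of v with the
   A_infinity relation on x, which vanishes. *)
Require Import Defs.
From HB Require Import structures.
From mathcomp Require Import all_boot all_order all_algebra perm.
From mathcomp Require Import generic_quotient ring_quotient sesquilinear.
From mathcomp Require Import all_classical reals.
From mathcomp Require Import zify.

Import GRing.Theory Num.Theory Order.TTheory.

Local Open Scope classical_set_scope.
Local Open Scope ring_scope.
Local Open Scope quotient_scope.

Set Implicit Arguments.
Unset Strict Implicit.
Unset Printing Implicit Defensive.

(** * Parities of integers, which govern all Koszul signs *)

Definition oddz (n : int) : bool := odd `|n|%N.

Lemma oddzD a b : oddz (a + b) = oddz a (+) oddz b.
Proof.
(* Over [rat] a sign determines its parity, so the law of exponents applies. *)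
apply: (@signr_inj rat).
by rewrite signr_addb /oddz !signr_odd -!expN1r expfzDr.
Qed.

Lemma oddzN a : oddz (- a) = oddz a.
Proof. by rewrite /oddz abszN. Qed.

Lemma oddzM a b : oddz (a * b) = oddz a && oddz b.
Proof. by rewrite /oddz abszM oddM. Qed.

(** With boolean exponents, every sign identity becomes a case analysis on parities. *)
Lemma exprz_sign (K : fieldType) (n : int) : (-1 : K) ^ n = (-1) ^+ oddz n.
Proof.
rewrite /oddz; case: n => n; first by rewrite signr_odd.
by rewrite NegzE abszN absz_nat -exprnN invr_sign signr_odd.
Qed.

(** * Calculus of continuous linear extensions *)

Section BindTheory.
Context (R : realType) (K : fieldType).

(** Lets parities known only on the support of [f] be used under [bind]. *)
Lemma eq_bind_supp (X Y : choiceType) (f : nov R K X) (g h : X -> nov R K Y) :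
  (forall s, f s != 0 -> g s.2 = h s.2) -> bind f g = bind f h.
Proof.
move=> gh; apply: novP => p; rewrite !(@bindE _ _ _ _ (nsupp f p.1.1)) //.
by apply: eq_fsbigr => s; rewrite inE => -[_ fs]; rewrite gh.
Qed.

Lemma bind_mono1 (X Y : choiceType) x (g : X -> nov R K Y) :
  bind (mono R 1 x) g = g x.
Proof. by apply: novP => p; rewrite bind_monol mul1r. Qed.

Lemma bind0r (X Y : choiceType) (f : nov R K X) :
  bind f (fun=> 0 : nov R K Y) = 0.
Proof.
apply: novP => p; rewrite (@bindE _ _ _ _ (nsupp f p.1.1)) //.
by apply: fsbig1 => s _; rewrite mulr0.
Qed.

(** Since energies are nonnegative, a coefficient of energy [E] involves only the finitely many
    terms of [f] and [g] of energy at most [E]; the finite sums commute. *)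
Lemma bind_exchange (X Y Z : choiceType) (f : nov R K X) (g : nov R K Y)
    (h : X -> Y -> nov R K Z) :
  bind f (fun x => bind g (h x)) = bind g (fun y => bind f (h^~ y)).
Proof.
apply: novP => p; set E := p.1.1.
pose F (s : R * int * X) (r : R * int * Y) := f s * g r *
  h s.2 r.2 (E - s.1.1 - r.1.1, p.1.2 - s.1.2 - r.1.2, p.2).
transitivity (\sum_(s \in nsupp f E) \sum_(r \in nsupp g E) F s r).
  rewrite (@bindE _ _ _ _ (nsupp f E)) //; apply: eq_fsbigr => s.
  rewrite inE => -[sE fs]; rewrite (@bindE _ _ _ _ (nsupp g E)).
    rewrite mulr_fsumr; first by apply: eq_fsbigr => r _; rewrite mulrA.
  move=> r [/= rE gr]; split=> //; apply: le_trans rE _.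
  by rewrite gerBl leNgt; apply: contra fs => s0; rewrite nov_lt0.
rewrite exchange_fsbig; [|exact: nov_fin|exact: nov_fin].
rewrite (@bindE _ _ _ _ (nsupp g E)) //; apply: eq_fsbigr => r.
rewrite inE => -[rE gr]; rewrite (@bindE _ _ _ _ (nsupp f E)).
  rewrite mulr_fsumr; apply: eq_fsbigr => s _.
  by rewrite /F /= [f s * _]mulrC mulrA (addrAC _ (- s.1.1)) (addrAC _ (- s.1.2)).
move=> s [/= sE fs]; split=> //; apply: le_trans sE _.
by rewrite gerBl leNgt; apply: contra gr => r0; rewrite nov_lt0.
Qed.

(** Scaling by [a] is itself a [bind] over the one-point set. *)
Lemma bindZr (X Y : choiceType) (f : nov R K X) (a : novikov R K)
    (g : X -> nov R K Y) :
  bind f (fun x => a *: g x) = a *: bind f g.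
Proof. exact: bind_exchange. Qed.

Lemma bind_monor (X Y : choiceType) (f : nov R K X) (c : X -> K) (h : X -> Y) p :
  bind f (fun x => mono R (c x) (h x)) p =
  \sum_(x \in [set x | h x = p.2]) f (p.1, x) * c x.
Proof.
case: p => -[l q] y /=; rewrite /bind_fun.
pose D : set (R * int * X) := (fun x => (l, q, x)) @` [set x | h x = y].
rewrite -(@fsbig_widen _ _ _ _ D) //; last first.
  move=> [[l' q'] x] /= [_ Dx]; rewrite /mono_fun; case: eqP => [[]|]; last by rewrite mulr0.
  move=> /eqP; rewrite subr_eq0 => /eqP lE /eqP; rewrite subr_eq0 => /eqP qE yE.
  by case: Dx; exists x => //; rewrite -lE -qE.
rewrite fsbig_image; last by move=> x x' _ _ [].
by apply: eq_fsbigr => x; rewrite inE /= /mono_fun => ->; rewrite !subrr eqxx.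
Qed.

Lemma bind_mono (X : choiceType) (f : nov R K X) : bind f (mono R 1) = f.
Proof.
apply: novP => p; rewrite bind_monor (_ : [set _ | _] = [set p.2]) //.
by rewrite fsbig_set1 mulr1 -surjective_pairing.
Qed.

Lemma nov_signE (X : choiceType) (b : bool) (f : nov R K X) p :
  nov_fun ((-1) ^+ b *: f) p = (-1) ^+ b * f p.
Proof. by rewrite scaler_sign mulr_sign; case: b. Qed.

Lemma mono_signM (X : choiceType) (b : bool) (c : K) (x : X) :
  mono R ((-1) ^+ b * c) x = (-1) ^+ b *: mono R c x :> nov R K X.
Proof.
apply: novP => p; rewrite nov_signE /= /mono_fun.
by case: ifP => //; rewrite mulr0.
Qed.

Lemma mono_sign (X : choiceType) (n : int) (x : X) :
  mono R ((-1) ^ n) x = (-1) ^+ oddz n *: mono R (1 : K) x :> nov R K X.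
Proof.
by rewrite exprz_sign -mono_signM mulr1.
Qed.

End BindTheory.

(** * Degrees of words, and operations on tuples of basis vectors *)

Section Words.
Context (R : realType) (K : fieldType) (A : ainf_ops R K).
Local Notation I := (idx A).
Local Notation sdeg := (sdeg (@deg _ _ A)).
Local Notation wdeg := (wdeg (@deg _ _ A)).

Lemma wdeg_cat u w : wdeg (u ++ w) = wdeg u + wdeg w.
Proof. exact: big_cat. Qed.

Lemma wdeg_cons i w : wdeg (i :: w) = sdeg i + wdeg w.
Proof. exact: big_cons. Qed.

Lemma wdeg_nil : wdeg [::] = 0. Proof. exact: big_nil. Qed.

Lemma mcoef_tuple k b (t : k.-tuple I) :
  mcoef b t = op A k b (tpure (fun i => evec K (tnth t i))).
Proof.
case: t => w wk; have Ek := eqP wk; subst k; rewrite /mcoef /=.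
congr (op _ _ _ (tpure _)); apply/funext => i.
by congr (evec K (tnth _ i)); apply: val_inj.
Qed.

Lemma shomog_evec i : shomog (@deg _ _ A) (sdeg i) (evec K i).
Proof. by move=> j; rewrite ffunE; case: (i =P j) => [->|]; rewrite ?eqxx. Qed.

Lemma wdeg_tnth k (t : k.-tuple I) : wdeg t = \sum_i sdeg (tnth t i).
Proof. exact: big_tuple. Qed.

End Words.

(** * Parity of the operations and the relation satisfied by [m] *)

Section Algebra.
Context (R : realType) (K : fieldType) (A : ainf R K).
Local Notation I := (idx A).
Local Notation sdeg := (sdeg (@deg _ _ A)).
Local Notation wdeg := (wdeg (@deg _ _ A)).

(** The degree of [op] is 1 minus the even number [2 * q], so [m] reverses parity whatever the power
    of [e]. *)
Lemma m_odd w s : m w s != 0 -> oddz (sdeg s.2) = ~~ oddz (wdeg w).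
Proof.
case: s => -[l q] y /=; rewrite /m_fun /=; case: asboolP => [Gb|]; last by rewrite eqxx.
move=> my; have xd i : shomog (@deg _ _ A) (sdeg (tnth (in_tuple w) i))
    (evec K (tnth (in_tuple w) i)) by apply: shomog_evec.
rewrite (@op_deg _ _ A _ _ _ _ Gb xd y my) -(wdeg_tnth (in_tuple w)) !oddzD oddzN oddzM /=.
by rewrite addbF addbT.
Qed.


(* The component of [dhat (dhat w) = 0] in words of length one. *)
Lemma ainf_relation w :
  \sum_(i < (size w).+1) \sum_(j < (size w).+1 | (i + j <= size w)%N)
    (-1) ^+ oddz (wdeg (take i w)) *:
    bind (m (take j (drop i w))) (fun y => m (take i w ++ y :: drop (i + j) w))
  = 0 :> nov R K I.
Proof.
pose pr (w : seq I) : nov R K I := if w is [:: y] then mono R 1 y else 0.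
(* Applying an operation of arity k leaves a word of length [size w' - k + 1], so [pr] keeps only
   the term where [m] takes the whole word. *)
have prd w' : bind (dhat_gen w') pr = m w'.
  rewrite -[LHS]/(lext pr _) linear_sum (bigD1 ord_max) //= big1 => [|k kw].
    rewrite addr0 /mhat_gen leqnn subnn linear_sum big_ord_recl big_ord0 addr0 /=.
    rewrite take0 drop0 take_size drop_oversize //= wdeg_nil expr0z.
    rewrite /lext bindA -[RHS]bind_mono; congr bind; apply/funext => y.
    by rewrite bind_mono1.
  have {}kw : (k < size w')%N.
    by rewrite ltn_neqAle -ltnS ltn_ord andbT; apply: contra kw => /eqP kw; apply/eqP/val_inj.
  rewrite /mhat_gen ltnW // linear_sum big1 // => i _.
  rewrite /= /lext bindA -[RHS](bind0r _ (m (take k (drop i w')))).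
  congr bind; apply/funext => y; rewrite mono_sign /pr.
  rewrite -[LHS]/(lext _ _) linearZ /= /lext bind_mono1.
  rewrite -[X in _ *: X]/(pr _).
  set u := _ ++ _; suff : size u != 1%N by case: u => [|? [|? ?]] //; rewrite scaler0.
  have iw : (i + k <= size w')%N by have := ltn_ord i; lia.
  by rewrite size_cat /= size_takel ?size_drop; lia.
have := @dhat_sq _ _ A (mono R 1 w).
rewrite /dhat /lext bind_mono1 => /(congr1 (fun f => bind f pr)).
rewrite bindA; under [X in bind _ X]eq_fun do rewrite prd.
rewrite -[X in _ = X]/(lext pr 0) linear0 => H.
(* [dhat_gen] sums over the arity [j] first, the statement over the position [i]. *)
rewrite -[RHS]H (exchange_big_dep xpredT) //= -[RHS]/(lext _ _) linear_sum /=.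
apply: eq_bigr => j _; rewrite /mhat_gen -ltnS ltn_ord linear_sum /=.
have jw : (j <= size w)%N by rewrite -ltnS.
pose F (i : nat) : nov R K I := (-1) ^+ oddz (wdeg (take i w)) *:
  bind (m (take j (drop i w))) (fun y => m (take i w ++ y :: drop (i + j) w)).
transitivity (\sum_(i < (size w - j).+1) F i); last first.
  apply: eq_bigr => i _; rewrite /F /lext bindA -bindZr; congr bind; apply/funext => y.
  by rewrite mono_sign -[RHS]/(lext _ _) linearZ /= /lext bind_mono1.
rewrite (big_ord_widen (size w).+1 F) ?ltnS ?leq_subr //.
by apply: eq_bigl => i; rewrite ltnS leq_subRL // addnC.
Qed.

End Algebra.

(** * The pairing, and rotation of cyclic words *)

Section Cyclic.
Context (R : realType) (K : fieldType) (A : cyclic_ainf R K).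
Local Notation I := (idx A).
Local Notation sdeg := (sdeg (@deg _ _ A)).
Local Notation wdeg := (wdeg (@deg _ _ A)).
Local Notation pair := (lpair (A := A)).

Lemma lpair_mono1 (f : nov R K I) z p :
  pair f (mono R 1 z) p =
  \sum_(i : I) f (p.1, i) * pairing A (evec K i) (evec K z).
Proof.
rewrite /lpair /lext; under [X in bind _ X]eq_fun do rewrite bind_mono1.
rewrite bind_monor (_ : [set _ | _] = setT); last by apply/seteqP; split=> // x _; case: p.2.
rewrite [RHS]fsbig_seq ?index_enum_uniq //.
rewrite (_ : [set` _] = setT) //.
by apply/seteqP; split=> i // _; rewrite /= mem_index_enum.
Qed.

Lemma lpairE (f g : nov R K I) : pair f g = bind g (fun z => pair f (mono R 1 z)).
Proof.
rewrite {1}/lpair /lext bind_exchange; congr bind; apply/funext => z.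
by rewrite /lpair /lext; congr bind; apply/funext => i; rewrite bind_mono1.
Qed.

(** The sign [- (-1) ^ (p * q)] of [pair_skew] is -1 unless both degrees are odd. *)
Lemma lpair_skew (f g : nov R K I) (a b : bool) :
    (forall s, f s != 0 -> oddz (sdeg s.2) = a) ->
    (forall s, g s != 0 -> oddz (sdeg s.2) = b) ->
  pair f g = (-1) ^+ (~~ (a && b)) *: pair g f.
Proof.
move=> fa gb; rewrite /lpair /lext bind_exchange -bindZr.
apply: eq_bind_supp => s gs; rewrite -bindZr; apply: eq_bind_supp => r fr.
rewrite (@pair_skew _ _ A (sdeg r.2) (sdeg s.2)); [|exact: shomog_evec..].
by rewrite exprz_sign oddzM fa // gb // -signrN mono_signM.
Qed.

(** [m^+] on plain words, without a distinguished first letter, so that words can be cut and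
    rotated; the empty word gets a default value. *)
Definition mword (w : seq I) : novikov R K :=
  if w is v :: x then mplus_gen (v, x) else 0.

Lemma mword_rcons w z : mword (rcons w z) = pair (m w) (mono R 1 z).
Proof. by case: w => [|v w] //=; rewrite /mplus_gen /= belast_rcons last_rcons. Qed.

(** Isolates a single [m_{k,beta}], the level at which cyclicity is assumed. *)
Lemma mword_rconsE w z p : mword (rcons w z) p =
  if `[< gap (mon A) (p.1.1, 2 * p.1.2) >] then
    pairing A (mcoef (p.1.1, 2 * p.1.2) w) (evec K z) else 0.
Proof.
rewrite mword_rcons lpair_mono1 /m /= /m_fun /=; case: asboolP => _; last first.
  by rewrite big1 // => i _; rewrite mul0r.
set c := mcoef _ _; transitivity (pairing A (\sum_i c i *: evec K i) (evec K z)).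
  rewrite (big_morph _ (linearDl _ (evec K z)) (linear0l _ _)).
  by apply: eq_bigr => i _; rewrite linearZl_LR.
congr (pairing A _ _); apply/ffunP => j; rewrite sum_ffunE (bigD1 j) //= big1.
  by rewrite addr0 !ffunE eqxx [_ *: _]mulr1.
by move=> i ij; rewrite !ffunE (negbTE ij) [_ *: _]mulr0.
Qed.

Lemma mword_rot1 v x :
  mword (v :: x) = (-1) ^+ (oddz (sdeg v) && oddz (wdeg x)) *: mword (rcons x v).
Proof.
case: (lastP x) => [|{}x z]; first by rewrite wdeg_nil andbF scale1r.
apply: novP => p; rewrite -oddzM -rcons_cons nov_signE !mword_rconsE.
case: asboolP => [Gb|_]; last by rewrite mulr0.
set b := (_, 2 * _).
pose n := (size x).+1.
pose t : n.+1.-tuple I := [tuple of v :: rcons_tuple (in_tuple x) z].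
have td i : shomog (@deg _ _ A) (sdeg (tnth t i)) (evec K (tnth t i)).
  exact: shomog_evec.
(* The two words are [t] without its last and without its first letter, as in [pair_cyclic]. *)
have E1 : v :: x = [tuple tnth t (lift ord_max i) | i < n].
  apply: (@eq_from_nth _ z) => [|i ix]; first by rewrite size_tuple.
  rewrite (nth_mktuple _ _ (Ordinal ix)) (tnth_nth z) lift_max /=.
  by rewrite -rcons_cons nth_rcons /= ix.
have E2 : rcons x z = [tuple tnth t (lift ord0 i) | i < n].
  apply: (@eq_from_nth _ z) => [|i]; first by rewrite size_tuple size_rcons.
  rewrite size_rcons => ix.
  by rewrite (nth_mktuple _ _ (Ordinal ix)) (tnth_nth z).
have opE (h : 'I_n -> 'I_n.+1) :
    mcoef b [tuple tnth t (h i) | i < n] =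
    op A n b (tpure (fun i => evec K (tnth t (h i)))).
  rewrite mcoef_tuple; congr (op _ _ _ (tpure _)).
  by apply/funext => i; rewrite tnth_mktuple.
rewrite E1 E2 !opE wdeg_tnth.
have -> : z = tnth t ord_max by rewrite (tnth_nth z) /= nth_rcons ltnn eqxx.
rewrite (pair_cyclic Gb td) exprz_sign; congr ((-1) ^+ oddz (_ * _) * _).
by apply: eq_bigr => i _; rewrite tnth_mktuple.
Qed.

(** The letters of [u] are rotated one at a time, and their Koszul signs multiply. *)
Lemma mword_catC u w :
  mword (u ++ w) = (-1) ^+ (oddz (wdeg u) && oddz (wdeg w)) *: mword (w ++ u).
Proof.
elim: u w => [|v u IHu] w; first by rewrite wdeg_nil scale1r cats0.
rewrite cat_cons mword_rot1 rcons_cat IHu scalerA -signr_addb cat_rcons.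
rewrite -cats1 !wdeg_cat !wdeg_cons wdeg_nil addr0 !oddzD; congr (_ ^+ _ *: _).
by do 4!case: (oddz _).
Qed.

(** Moving [C] to the front makes the inserted letter last; by [m_odd] its parity is opposite to
    that of [B]. *)
Lemma mword_insert P B C :
  bind (m B) (fun y => mword (P ++ y :: C)) =
  (-1) ^+ (oddz (wdeg C) && ~~ (oddz (wdeg P) (+) oddz (wdeg B))) *:
    pair (m (C ++ P)) (m B).
Proof.
rewrite lpairE -bindZr; apply: eq_bind_supp => s /m_odd sB.
rewrite -cat_rcons mword_catC -rcons_cat mword_rcons -cats1 wdeg_cat wdeg_cons.
rewrite wdeg_nil addr0 oddzD sB andbC; congr (_ ^+ (_ && _) *: _).
by rewrite addbN.
Qed.

(** * Evaluation of [m^+] on the Hochschild differential *)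

Lemma mplus_lext_mono (n : int) (g : I -> I * seq I) (f : nov R K I) :
  mplus A (lext (fun y => mono R ((-1) ^ n) (g y)) f) =
  (-1) ^+ oddz n *: bind f (fun y => mplus_gen (A := A) (g y)).
Proof.
rewrite -bindZr /mplus /lext bindA; congr bind; apply/funext => y.
by rewrite mono_sign -[LHS]/(lext _ _) linearZ /= /lext bind_mono1.
Qed.

Lemma wdeg_split (x : seq I) i j :
  wdeg x = wdeg (take i x) + wdeg (take j (drop i x)) + wdeg (drop (i + j) x).
Proof. by rewrite -wdeg_cat -takeD -wdeg_cat cat_take_drop. Qed.

(* Rotating [v] to the last place turns the sum into the pairing of [v] with
   the A_infinity relation on [x]. *)
Lemma mplus_inner_sum v (x : seq I) :
  \sum_(i < (size x).+1) \sum_(j < (size x).+1 | (i + j <= size x)%N)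
    (-1) ^+ oddz (sdeg v + wdeg (take i x)) *:
    bind (m (take j (drop i x)))
      (fun y => mplus_gen (A := A) (v, take i x ++ y :: drop (i + j) x)) = 0.
Proof.
pose hv i : novikov R K :=
  lext (fun j => mono R (pairing A (evec K i) (evec K j)) tt) (mono R 1 v).
(* The word that [v] is rotated past has parity opposite to that of [x], since [m] is odd; hence the
   sign [c] is common to all terms. *)
pose c := oddz (sdeg v) (+) (oddz (sdeg v) && ~~ oddz (wdeg x)).
have E : 0 = (-1) ^+ c *: lext hv 0 by rewrite linear0 scaler0.
rewrite [RHS]E -(ainf_relation x) linear_sum scaler_sumr; apply: eq_bigr => i _.
rewrite linear_sum scaler_sumr; apply: eq_bigr => j _.
rewrite linearZ /= scalerA -signr_addb /lext bindA -!bindZr.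
apply: eq_bind_supp => s /m_odd sB; rewrite -[mplus_gen _]/(mword (v :: _)).
rewrite mword_rot1 mword_rcons scalerA -signr_addb; congr (_ ^+ _ *: _).
rewrite wdeg_cat wdeg_cons /c (wdeg_split x i j) !(oddzD (wdeg _)) (oddzD (sdeg v)).
rewrite (oddzD (sdeg s.2)) sB (oddzD (_ + _)) oddzD.
by do 4!case: (oddz _).
Qed.

(* The arc containing [v] that starts [k - (i + j)] letters before it and ends
   [i] letters after it is the complement of the inner arc [(i, j)]. *)
Lemma mplus_outer_term v (x : seq I) (k := size x) i j : (i + j <= k)%N ->
  (-1) ^+ oddz (wdeg (drop (k - (k - (i + j))) x) *
                (sdeg v + wdeg (take (k - (k - (i + j))) x))) *:
    bind (m (drop (k - (k - (i + j))) x ++ v :: take i x))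
      (fun y => mplus_gen (A := A) (y, drop i (take (k - (k - (i + j))) x))) =
  (-1) ^+ oddz (sdeg v + wdeg (take i x)) *:
    bind (m (take j (drop i x)))
      (fun y => mplus_gen (A := A) (v, take i x ++ y :: drop (i + j) x)).
Proof.
move=> ijk; rewrite subKn //; set B := take j _; set C := drop _ x.
have -> : drop i (take (i + j) x) = B by rewrite addnC -take_drop.
(* The two sides become the pairings of [m B] and [m (C ++ v :: take i x)] in opposite orders. *)
rewrite (mword_insert [::] (C ++ v :: take i x) B).
rewrite (mword_insert (v :: take i x) B C).
rewrite cats0 (lpair_skew (@m_odd _ _ A _) (@m_odd _ _ A _)) !scalerA -!signr_addb.
congr (_ ^+ _ *: _); rewrite takeD -/B !wdeg_cat !wdeg_cons wdeg_nil oddzM.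
rewrite !(oddzD (wdeg _)) !(oddzD (sdeg v)) (oddzD (wdeg _)).
by do 4!case: (oddz _).
Qed.

(** A pair cuts [n] into the parts [i], [j] and [n - (i + j)]; the substitution permutes these
    cyclically. *)
Lemma sum_arcs (V : nmodType) n (F : nat -> nat -> V) :
  \sum_(i < n.+1) \sum_(j < n.+1 | (i + j <= n)%N) F i j =
  \sum_(i < n.+1) \sum_(j < n.+1 | (i + j <= n)%N) F (n - (i + j))%N i.
Proof.
rewrite !pair_big_dep /=.
pose T := ('I_n.+1 * 'I_n.+1)%type.
pose h (p : T) : T := (inord (n - (p.1 + p.2)), p.1).
pose h' (p : T) : T := (p.2, inord (n - (p.1 + p.2))).
rewrite (reindex_onto h h') => [|[i j] /= ijn]; last first.
  congr (_, _); apply: val_inj; rewrite /= !inordK ?ltnS ?leq_subr //=; lia.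
apply: eq_big => [[i j]|[i j] _] /=; last by rewrite inordK // ltnS leq_subr.
(* If [i + j > n], the truncated subtraction gives 0 and [h'] does not undo [h], so such pairs drop
   out. *)
rewrite !inordK ?ltnS ?leq_subr //; apply/andP/idP => [[h1 /eqP[]]|ijn].
  move=> /(congr1 val) /=; rewrite inordK ?ltnS ?leq_subr //; lia.
split; first by lia.
apply/eqP; congr (_, _); apply: val_inj; rewrite /= !inordK ?ltnS ?leq_subr //; lia.
Qed.

(** Each of the two sums vanishes: reindexed by complementary arcs, the second agrees with the first
    term by term. *)
Lemma mplus_dhoch_gen c : mplus A (dhoch_gen c) = 0.
Proof.
case: c => v x; rewrite -[LHS]/(lext _ _) linearD !linear_sum /=.
pose F i j : novikov R K := let l := (size x - i)%N in
  mplus A (lext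
    (fun y => mono R ((-1) ^ (wdeg (drop l x) * (sdeg v + wdeg (take l x))))
                (y, drop j (take l x)))
    (m (drop l x ++ v :: take j x))).
rewrite [X in _ + X](_ : _ = \sum_(i < (size x).+1)
   \sum_(j < (size x).+1 | (i + j <= size x)%N) F i j); last first.
  by apply: eq_bigr => i _; rewrite linear_sum.
rewrite sum_arcs; apply: etrans (addr0 (0 : novikov R K)).
congr (_ + _); rewrite -[RHS](mplus_inner_sum v x); apply: eq_bigr => i _.
  by rewrite linear_sum; apply: eq_bigr => j ij; apply: mplus_lext_mono.
by apply: eq_bigr => j ij; rewrite /F mplus_lext_mono mplus_outer_term.
Qed.

Lemma mplus_dhoch c : mplus A (dhoch A c) = 0.
Proof.
rewrite /mplus /dhoch /lext bindA -[RHS](bind0r _ c); congr bind.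
by apply/funext => x; apply: mplus_dhoch_gen.
Qed.

Lemma mplus_homology (S : zmodClosed (hoch A)) :
  exists f : homology (dhoch A) S -> novikov R K,
    forall z : cycles (dhoch A) S, f (\pi z) = mplus A (cycle_val z).
Proof.
(* Evaluation on a chosen representative; another one differs by some [dhoch A y], which [mplus]
   kills. *)
exists (fun q => mplus A (cycle_val (repr q))) => z.
have : repr (\pi_(homology (dhoch A) S) z) = z %[mod homology (dhoch A) S].
  exact: reprK.
move/eqP; rewrite -Quotient.idealrBE => /asboolP[y _ yz].
apply/eqP; rewrite -subr_eq0 -[_ - _]bindBl -[_ - _ : hoch A]yz.
exact/eqP/mplus_dhoch.
Qed.

End Cyclic.

Theorem theorem4p1 (R : realType) (K : fieldType) (charK : [pchar K] =i pred0)
    (A : cyclic_ainf R K) :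
  [/\ forall c : hoch A, mplus A (dhoch A c) = 0,
      exists f : hoch_coker A -> novikov R K,
        forall c : hoch A, f (\pi c) = mplus A c,
      exists f : hoch_homology A -> novikov R K,
        forall z : hoch_cycles A, f (\pi z) = mplus A (cycle_val z)
    & exists f : ce_homology A -> novikov R K,
        forall z : ce_cycles A, f (\pi z) = mplus A (cycle_val z)].
Proof.
split; [exact: mplus_dhoch | | exact: mplus_homology | exact: mplus_homology].
exists (fun q => mplus A (repr q)) => c.
have : repr (\pi_(hoch_coker A) c) = c %[mod hoch_coker A] by apply: reprK.
move/eqP; rewrite -Quotient.idealrBE => /asboolP[y yc].
apply/eqP; rewrite -subr_eq0 -[_ - _]bindBl -[_ - _ : hoch A]yc.
exact/eqP/mplus_dhoch.
Qed.
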